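(* Any Chabauty limit of $\mathrm{SL}(2,\mathbb{R})$ inside $\mathrm{SL}(2,\mathbb{C})$ is $\mathrm{SL}(2,\mathbb{C})$-conjugate to either $\mathrm{SL}(2,\mathbb{R})$, or to the subgroup $$\left\{\begin{pmatrix} a-ib& z\\ 0& a+ib\end{pmatrix}\ \middle|\ a,b\in\mathbb{R}\text{ with }a^2+b^2=1,\ z\in\mathbb{C}\right\}\leq B_{\mathbb{C}}^{+}.$$
   Context: For a locally compact group $G$, the set $\mathcal{S}(G)$ of closed subgroups carries the Chabauty topology; for $G$ metrizable, $H_n\to H$ in $\mathcal{S}(G)$ iff (1) every $h\in H$ is the limit of some sequence $h_n\in H_n$, and (2) whenever $h_n\in H_n$ and a subsequence $h_{n_k}$ converges to some $h\in G$, then $h\in H$. A Chabauty limit of a closed subgroup $H\le G$ inside $G$ is a closed subgroup that is a limit in $\mathcal{S}(G)$ of a sequence of conjugates $g_nHg_n^{-1}$, $g_n\in G$. $B_{\mathbb{C}}^{+}$ is the group of upper triangular matrices in $\mathrm{SL}(2,\mathbb{C})$. *)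

(* Defs.v *)
From HB Require Import structures.
From mathcomp Require Import all_boot all_order all_algebra.
From mathcomp Require Import all_classical all_reals all_analysis.
From mathcomp Require Import complex.

Set Implicit Arguments.
Unset Strict Implicit.
Unset Printing Implicit Defensive.

Import Order.TTheory GRing.Theory Num.Theory.
Import numFieldNormedType.Exports.

Local Open Scope classical_set_scope.
Local Open Scope ring_scope.
Local Open Scope complex_scope.

(* The topology of R[i] is the one of its modulus. The topology of 'M[R[i]]_2,
   hence the subspace topology of SL(2, C), is then the library's entrywise
   one. For lemmas about a [K : numFieldType], it may be necessary to give
   [K := R[i]] explicitly, because unification can be slow otherwise. *)
HB.instance Definition _ (R : rcfType) := NormedModule.copy R[i] R[i]^o.

(* Sequential description of Hn --> H in the Chabauty space of a metrizable
   group G, which is here a subspace of T; condition (2) only concerns the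
   limits [h] that lie in G. *)
Definition chabauty_cvg (T : topologicalType) (G : set T)
    (Hn : nat -> set T) (H : set T) : Prop :=
  (forall h, H h ->
     exists2 u : nat -> T, (forall n, Hn n (u n)) & u @ \oo --> h) /\
  (forall (u : nat -> T) (k : nat -> nat) (h : T),
     (forall n, Hn n (u n)) -> {homo k : m n / (m < n)%N} ->
     (u \o k) @ \oo --> h -> G h -> H h).

Definition is_subgroup (K : comUnitRingType) (n : nat)
    (G H : set 'M[K]_n) : Prop :=
  [/\ H `<=` G,
      H 1%:M,
      forall A B, H A -> H B -> H (A *m B) &
      forall A, H A -> H (invmx A)].

(* [H] is closed for the topology induced on [G]. *)
Definition is_closed_subgroup (R : realType) (G H : set 'M[R[i]]_2) : Prop :=
  is_subgroup G H /\ closure H `&` G `<=` H.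

Definition conj_subgroup (K : comUnitRingType) (n : nat)
    (g : 'M[K]_n) (H : set 'M[K]_n) : set 'M[K]_n :=
  [set g *m h *m invmx g | h in H].

Definition is_chabauty_limit (R : realType) (G H L : set 'M[R[i]]_2) : Prop :=
  is_closed_subgroup G L /\
  exists2 g : nat -> 'M[R[i]]_2, (forall n, G (g n)) &
    chabauty_cvg G (fun n => conj_subgroup (g n) H) L.

Definition SL2 (K : comNzRingType) : set 'M[K]_2 := [set A | \det A = 1].
Arguments SL2 : clear implicits.

Definition SL2C (R : realType) : set 'M[R[i]]_2 := SL2 R[i].
Arguments SL2C : clear implicits.

Definition SL2R (R : realType) : set 'M[R[i]]_2 :=
  map_mx (real_complex R) @` SL2 R.
Arguments SL2R : clear implicits.

Definition mx2 (K : pzRingType) (a b c d : K) : 'M[K]_2 :=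
  \matrix_(i < 2, j < 2) (nth [::] [:: [:: a; b]; [:: c; d]] i)`_j.

Definition borelC (R : realType) : set 'M[R[i]]_2 :=
  [set A | SL2C R A /\ A ord_max ord0 = 0].
Arguments borelC : clear implicits.

Definition circle_translations (R : realType) : set 'M[R[i]]_2 :=
  [set A | exists (a b : R) (z : R[i]),
     a ^+ 2 + b ^+ 2 = 1 /\ A = mx2 (a -i* b) z 0 (a +i* b)].
Arguments circle_translations : clear implicits.

(* Main.v *)
Require Import Defs.
From mathcomp Require Import all_boot all_order all_algebra.
From mathcomp Require Import all_classical all_reals all_analysis.
From mathcomp Require Import complex ring lra.

Set Implicit Arguments.
Unset Strict Implicit.
Unset Printing Implicit Defensive.

Import Order.TTheory GRing.Theory Num.Theory.
Import numFieldNormedType.Exports.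

Local Open Scope classical_set_scope.
Local Open Scope ring_scope.
Local Open Scope complex_scope.

(** The conjugates of SL(2,R) are stabilizers of Hermitian forms, and limits
of stabilizers are stabilizers of limits of forms.

For a Hermitian matrix M, let SU(M), here [form_group M], be the group of the
A in SL(2,C) with A M A^H = M, where A^H is the conjugate transpose of A. It
depends only on M up to a nonzero real factor, and SU(g M g^H) = g SU(M) g^-1
for g in SL(2,C). A matrix A with determinant 1 satisfies A E A^T = E for
E = [0, i; -i, 0], so A E A^H = E means that A is real: SL(2,R) = SU(E). Hence
g_n SL(2,R) g_n^-1 = SU(M_n) with M_n = g_n E g_n^H, a Hermitian matrix of
determinant -1.

Rescale the M_n to a bounded sequence that stays away from 0. A subsequence
converges to a Hermitian M <> 0, with det M <= 0 ([herm_subsequence]). The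
equation A M A^H = M passes to the limit, so L is contained in SU(M). The
converse needs that every A in SU(M) is a limit of elements of SU(M_n)
([form_group_approx]); this holds even when M is degenerate, because SU(M) does
not change dimension there. Concretely, if the upper left entry m of M is not
0, then an A in SU(M) is determined by its first row r, through formulas that
are rational in M, and r is subject only to r M r^H = m ([completionE],
[form_group_completion]). The same row, rescaled, thus gives elements of
SU(M_n) near A. A change of basis gives m <> 0 ([herm_pivot]). Condition (2) of
Chabauty convergence then yields L = SU(M).

It remains to classify the nonzero Hermitian M with det M <= 0 up to
congruence and real factors ([herm_classification]): completing the square
leads to diag(1, t) with t <= 0. For t < 0 this is congruent to E and L is
conjugate to SL(2,R); for t = 0 it is diag(1, 0), whose stabilizer is the group
of circle translations ([form_group_diag10]). *)

(** * Matrices of size two *)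

Lemma mx2_eta (K : pzRingType) (A : 'M[K]_2) :
  A = mx2 (A ord0 ord0) (A ord0 ord_max) (A ord_max ord0) (A ord_max ord_max).
Proof.
apply/matrixP=> i j; rewrite mxE.
by case: i j => [[|[|//]] hi] [[|[|//]] hj]; congr (A _ _); apply/val_inj.
Qed.

Lemma mx2_00 (K : pzRingType) (a b c d : K) : mx2 a b c d ord0 ord0 = a.
Proof. by rewrite mxE. Qed.
Lemma mx2_01 (K : pzRingType) (a b c d : K) : mx2 a b c d ord0 ord_max = b.
Proof. by rewrite mxE. Qed.
Lemma mx2_10 (K : pzRingType) (a b c d : K) : mx2 a b c d ord_max ord0 = c.
Proof. by rewrite mxE. Qed.
Lemma mx2_11 (K : pzRingType) (a b c d : K) : mx2 a b c d ord_max ord_max = d.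
Proof. by rewrite mxE. Qed.
Definition mx2E := (mx2_00, mx2_01, mx2_10, mx2_11).

Lemma mx2_inj (K : pzRingType) (a b c d a' b' c' d' : K) :
  mx2 a b c d = mx2 a' b' c' d' -> [/\ a = a', b = b', c = c' & d = d'].
Proof.
move=> e; have h i j : mx2 a b c d i j = mx2 a' b' c' d' i j by rewrite e.
have := h ord0 ord0; have := h ord0 ord_max.
by have := h ord_max ord0; have := h ord_max ord_max; rewrite !mx2E.
Qed.

Lemma mx2_mul (K : pzRingType) (a b c d a' b' c' d' : K) :
  mx2 a b c d *m mx2 a' b' c' d' =
  mx2 (a * a' + b * c') (a * b' + b * d') (c * a' + d * c') (c * b' + d * d').
Proof.
rewrite [LHS]mx2_eta !mxE !big_ord_recl !big_ord0 !addr0.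
have -> : lift ord0 ord0 = ord_max :> 'I_2 by apply/val_inj.
by rewrite !mx2E.
Qed.

Lemma mx2_scale (K : pzRingType) (k a b c d : K) :
  k *: mx2 a b c d = mx2 (k * a) (k * b) (k * c) (k * d).
Proof.
by apply/matrixP=> -[[|[|//]] i] [[|[|//]] j]; rewrite !mxE.
Qed.

Lemma mx2_det (K : comNzRingType) (a b c d : K) :
  \det (mx2 a b c d) = a * d - b * c.
Proof.
rewrite (expand_det_row _ ord0) !big_ord_recl big_ord0 addr0 /cofactor !det_mx11.
by rewrite !mxE /= expr0 expr1 mul1r mulN1r mulrN.
Qed.

Lemma mx2_1 (K : nzRingType) : 1%:M = mx2 1 0 0 1 :> 'M[K]_2.
Proof. by rewrite [LHS]mx2_eta !mxE. Qed.

(** The imaginary unit under a name of its own, so that it is a single atom for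
[ring]. *)
Definition imag (R : realType) : R[i] := 'i.

(** The Hermitian form that SL(2,R) preserves: the determinant form, times i. *)
Definition im_form (R : realType) : 'M[R[i]]_2 := mx2 0 (imag R) (- imag R) 0.

(** * Stabilizers of Hermitian forms *)

Section FormGroup.
Variable R : realType.
Implicit Types (A B g M N : 'M[R[i]]_2).

Lemma conjcM (u v : R[i]) : (u * v)^*%C = u^*%C * v^*%C.
Proof. exact: (rmorphM (@conjc R)). Qed.
Lemma conjcD (u v : R[i]) : (u + v)^*%C = u^*%C + v^*%C.
Proof. exact: (rmorphD (@conjc R)). Qed.
Lemma conjcB (u v : R[i]) : (u - v)^*%C = u^*%C - v^*%C.
Proof. exact: (rmorphB (@conjc R)). Qed.
Lemma conjcN (v : R[i]) : (- v)^*%C = - v^*%C.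
Proof. exact: (rmorphN (@conjc R)). Qed.

Definition conj_tr A : 'M[R[i]]_2 := (map_mx (@conjc R) A)^T.

Lemma conj_trE A i j : conj_tr A i j = (A j i)^*%C.
Proof. by rewrite !mxE. Qed.

Lemma conj_tr_mx2 (a b c d : R[i]) :
  conj_tr (mx2 a b c d) = mx2 a^*%C c^*%C b^*%C d^*%C.
Proof.
by apply/matrixP=> -[[|[|//]] i] [[|[|//]] j]; rewrite !mxE.
Qed.

Lemma conj_tr_mul A B : conj_tr (A *m B) = conj_tr B *m conj_tr A.
Proof. by rewrite /conj_tr map_mxM trmx_mul. Qed.

Lemma conj_trK : involutive conj_tr.
Proof. by move=> A; apply/matrixP=> i j; rewrite !mxE conjcK. Qed.

Lemma conj_tr1 : conj_tr 1%:M = 1%:M.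
Proof. by rewrite /conj_tr map_mx1 trmx1. Qed.

Lemma conj_tr_scale (c : R) A : conj_tr (c%:C *: A) = c%:C *: conj_tr A.
Proof. by apply/matrixP=> i j; rewrite !mxE rmorphM /= oppr0. Qed.

Lemma det_conj_tr A : \det (conj_tr A) = (\det A)^*.
Proof. by rewrite /conj_tr det_tr det_map_mx. Qed.

Definition form_group M : set 'M[R[i]]_2 :=
  [set A | \det A = 1 /\ A *m M *m conj_tr A = M].

Lemma SL2_unit A : \det A = 1 -> A \in unitmx.
Proof. by rewrite unitmxE => ->; rewrite unitr1. Qed.

Lemma form_group_subgroup M : is_subgroup (SL2C R) (form_group M).
Proof.
split=> [A []//| |A B [dA eA] [dB eB]|A [dA eA]].
- by split; rewrite ?det1 // conj_tr1 mul1mx mulmx1.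
- split; first by rewrite det_mulmx dA dB mulr1.
  by rewrite conj_tr_mul -[in RHS]eA -[in RHS]eB !mulmxA.
have uA := SL2_unit dA; split; first by rewrite det_inv dA invr1.
rewrite -[in LHS]eA -!mulmxA -conj_tr_mul mulVmx // conj_tr1 mulmx1 mulmxA mulVmx //.
by rewrite mul1mx.
Qed.

Lemma form_group_scale (c : R[i]) M :
  c != 0 -> form_group (c *: M) = form_group M.
Proof.
move=> c0; apply/seteqP; split=> A [dA eA]; split=> //.
  by apply: (scalerI c0); rewrite -[RHS]eA -scalemxAr -scalemxAl.
by rewrite -scalemxAr -scalemxAl eA.
Qed.

Lemma form_group_congr g M : SL2C R g ->
  form_group (g *m M *m conj_tr g) = conj_subgroup g (form_group M).
Proof.
move=> dg; have ug := SL2_unit dg.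
have ucg : conj_tr g \in unitmx by apply: SL2_unit; rewrite det_conj_tr dg conjc1.
have eqc : conj_tr g *m conj_tr (invmx g) = 1%:M by rewrite -conj_tr_mul mulVmx ?conj_tr1.
apply/seteqP; split=> [A [dA eA]|_ [h [dh eh] <-]].
  exists (invmx g *m A *m g); last by rewrite !mulmxA mulmxV // mul1mx mulmxK.
  split; first by rewrite !det_mulmx det_inv dA dg invr1 !mul1r.
  have -> : invmx g *m A *m g *m M *m conj_tr (invmx g *m A *m g) =
    invmx g *m (A *m (g *m M *m conj_tr g) *m conj_tr A) *m conj_tr (invmx g).
    by rewrite !conj_tr_mul !mulmxA.
  by rewrite eA -!mulmxA eqc mulmx1 mulmxA mulVmx // mul1mx.
split; first by rewrite !det_mulmx det_inv dh dg invr1 !mulr1.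
rewrite conj_tr_mul (conj_tr_mul g) !mulmxA mulmxKV // -(mulmxA _ (conj_tr g)) eqc mulmx1.
by rewrite -[in RHS]eh !mulmxA.
Qed.

(** The real coordinates of the space of Hermitian matrices; in them the
determinant is a quadratic form of Lorentz signature. *)
Definition herm (p s x y : R) : 'M[R[i]]_2 :=
  mx2 p%:C (x +i* y) (x -i* y) s%:C.

Lemma det_herm p s x y : \det (herm p s x y) = (p * s - x ^+ 2 - y ^+ 2)%:C.
Proof.
rewrite mx2_det; apply/eqP; rewrite eq_complex /=; apply/andP; split; apply/eqP; ring.
Qed.

Lemma self_adjoint_herm M : conj_tr M = M -> exists p s x y, M = herm p s x y.
Proof.
rewrite [M]mx2_eta conj_tr_mx2 => /mx2_inj[].
case: (M ord0 ord0) (M ord0 ord_max) (M ord_max ord0) (M ord_max ord_max)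
  => [p p'] [x y] [x' y'] [s s'] /= [hp] [-> <-] _ [hs].
have -> : p' = 0 by lra.
have -> : s' = 0 by lra.
by exists p, s, x, (- y'); rewrite /herm opprK.
Qed.

Lemma conj_tr_herm p s x y : conj_tr (herm p s x y) = herm p s x y.
Proof. by rewrite /herm conj_tr_mx2 !conjc_real /= opprK. Qed.

(** * The two model groups *)

(** A E A^T = (det A) E for this skew form E, so that A E A^H = E forces
A^H = A^T. In entries, a^* = a^* (a d - b c) = a (a^* d - b^* c) = a, and
similarly for b, c, d. *)
Lemma form_group_im : form_group (im_form R) = SL2R R.
Proof.
have i0 : imag R != 0 by rewrite eq_complex /= oner_eq0 andbF.
apply/seteqP; split=> [A|_ [B dB <-]]; last first.
  split; first by rewrite det_map_mx dB.
  have {}dB : \det B = 1 := dB; move: dB; rewrite [B]mx2_eta /im_form.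
  set a := B _ _; set b := B _ _.
  set c := B _ _; set d := B _ _; rewrite mx2_det => dB.
  have -> : map_mx (real_complex R) (mx2 a b c d) = mx2 a%:C b%:C c%:C d%:C.
    by apply/matrixP=> -[[|[|//]] i] [[|[|//]] j]; rewrite !mxE.
  have dC : a%:C * d%:C - b%:C * c%:C = 1 by rewrite -!rmorphM -rmorphB dB.
  rewrite conj_tr_mx2 !conjc_real !mx2_mul; congr mx2; first by ring.
  - by rewrite -[RHS]mulr1 -dC; ring.
  - by rewrite -[RHS]mulr1 -dC; ring.
  - ring.
rewrite [A]mx2_eta; set a := A _ _; set b := A _ _.
set c := A _ _; set d := A _ _.
case; rewrite mx2_det conj_tr_mx2 /im_form !mx2_mul => e /mx2_inj[e1 e2 _ e4].
have {}e1 : a * b^*%C - b * a^*%C = 0.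
  by apply: (mulfI i0); rewrite mulr0 -[RHS]e1; ring.
have {}e2 : a * d^*%C - b * c^*%C = 1.
  by apply: (mulfI i0); rewrite mulr1 -[RHS]e2; ring.
have {}e4 : c * d^*%C - d * c^*%C = 0.
  by apply: (mulfI i0); rewrite mulr0 -[RHS]e4; ring.
have e3 : a^*%C * d - b^*%C * c = 1.
  by rewrite -[RHS]conjc1 -e2 rmorphB !rmorphM /= !conjcK.
have ra : a^*%C = a.
  rewrite -[LHS]mulr1 -e -[RHS]mulr1 -[in RHS]e3.
  by apply/subr0_eq; rewrite -[RHS](mulr0 c) -[in RHS]e1; ring.
have rb : b^*%C = b.
  rewrite -[LHS]mulr1 -e -[RHS]mulr1 -[in RHS]e3.
  by apply/subr0_eq; rewrite -[RHS](mulr0 d) -[in RHS]e1; ring.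
have rc : c^*%C = c.
  rewrite -[LHS]mulr1 -e -[RHS]mulr1 -[in RHS]e2.
  by apply/subr0_eq; rewrite -[RHS](mulr0 (- a)) -[in RHS]e4; ring.
have rd : d^*%C = d.
  rewrite -[LHS]mulr1 -e -[RHS]mulr1 -[in RHS]e2.
  by apply/subr0_eq; rewrite -[RHS](mulr0 (- b)) -[in RHS]e4; ring.
have real (z : R[i]) : z^*%C = z -> z = (complex.Re z)%:C.
  by case: z => x y [/= h]; rewrite /real_complex_def; congr Complex; lra.
exists (mx2 (complex.Re a) (complex.Re b) (complex.Re c) (complex.Re d)).
  apply: (@complexI R); rewrite mx2_det rmorphB !rmorphM /=.
  by rewrite -!real.
apply/matrixP=> -[[|[|//]] i] [[|[|//]] j]; rewrite !mxE /=; exact/esym/real.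
Qed.

(** The form diag(1, 0) is |x|^2. Its equations read |a| = 1 and c = 0, and
det A = 1 then gives d = a^*. *)
Lemma form_group_diag10 : form_group (mx2 1 0 0 0) = circle_translations R.
Proof.
apply/seteqP; split=> [A|_ [a [b [z [e ->]]]]]; last first.
  have e' : (a -i* b) * (a +i* b) = 1.
    by apply/eqP; rewrite eq_complex /=; apply/andP; split; apply/eqP;
      rewrite -?e; ring.
  split; rewrite ?mx2_det ?conj_tr_mx2 ?mx2_mul; first by rewrite e' mulr0 subr0.
  rewrite conjc0; congr mx2; rewrite ?(mulr0, mul0r, addr0, add0r, mulr1) //=.
  by rewrite opprK.
rewrite [A]mx2_eta; set a := A _ _; set b := A _ _.
set c := A _ _; set d := A _ _.
case; rewrite mx2_det conj_tr_mx2 !mx2_mul.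
rewrite ?(mulr1, mulr0, mul0r, mul1r, addr0, add0r) => e /mx2_inj[e1 _ _].
move/eqP; rewrite mulf_eq0 conjc_eq0 orbb => /eqP c0.
move: e; rewrite c0 mulr0 subr0 => ed.
have da : d = a^*%C by rewrite -[LHS]mul1r -e1 mulrAC ed mul1r.
move: e1; rewrite da.
case: a {ed da} => x y; rewrite /= => -[e _].
exists x, (- y), b; rewrite opprK; split=> //.
by rewrite -e; ring.
Qed.

(** * Classification of forms *)

(** The real factor c may be negative: a form and its opposite have the same
stabilizer. *)
Definition congruent M N := exists2 g, SL2C R g &
  exists2 c : R, c != 0 & M = c%:C *: (g *m N *m conj_tr g).

Lemma congruent_trans N M P : congruent M N -> congruent N P -> congruent M P.
Proof.
move=> [g dg [c c0 ->]] [h dh [k k0 ->]]; exists (g *m h).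
  by rewrite /SL2C /SL2 /= det_mulmx dg dh mulr1.
exists (c * k); first by rewrite mulf_neq0.
by rewrite -scalemxAr -scalemxAl scalerA -rmorphM conj_tr_mul !mulmxA.
Qed.

Lemma congruent_pullback g M : SL2C R g -> congruent M (g *m M *m conj_tr g).
Proof.
move=> dg; have ug := SL2_unit dg; exists (invmx g).
  by rewrite /SL2C /SL2 /= det_inv dg invr1.
exists 1; rewrite ?oner_neq0 // scale1r !mulmxA mulVmx // mul1mx -mulmxA -conj_tr_mul.
by rewrite mulVmx // conj_tr1 mulmx1.
Qed.

Lemma congruent_form_group M N : congruent M N ->
  exists2 g, SL2C R g & form_group M = conj_subgroup g (form_group N).
Proof.
move=> [g dg [c c0 ->]]; exists g => //.
by rewrite form_group_scale ?form_group_congr // eq_complex /= eqxx andbT.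
Qed.

Lemma conj_tr_congr g M : conj_tr M = M ->
  conj_tr (g *m M *m conj_tr g) = g *m M *m conj_tr g.
Proof. by move=> hM; rewrite !conj_tr_mul conj_trK hM mulmxA. Qed.

Lemma det_congr g M : SL2C R g -> \det (g *m M *m conj_tr g) = \det M.
Proof. by move=> dg; rewrite !det_mulmx det_conj_tr dg conjc1 mul1r mulr1. Qed.

(** A nonzero Hermitian form has a vector v with v M v^H <> 0, and such a v can
be completed to a basis of determinant 1. *)
Lemma herm_pivot M : conj_tr M = M -> M != 0 ->
  exists2 g, SL2C R g & (g *m M *m conj_tr g) ord0 ord0 != 0.
Proof.
move=> /self_adjoint_herm[p [s [x [y ->]]]] M0.
have [p0|p0] := eqVneq p 0; last first.
  exists 1%:M; first exact: det1.
  by rewrite mul1mx conj_tr1 mulmx1 mx2E eq_complex /= (negbTE p0).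
have [s0|s0] := eqVneq s 0; last first.
  exists (mx2 0 1 (-1) 0).
    by rewrite /SL2C /SL2 /= mx2_det mul0r sub0r mul1r opprK.
  rewrite conj_tr_mx2 !mx2_mul mx2E conjc0 conjc1 !(mul0r, mulr0, mul1r, mulr1, add0r).
  by rewrite eq_complex /= (negbTE s0).
(* Both diagonal entries vanish; the vector (1, x + i y) has value
2 (x^2 + y^2). *)
exists (mx2 1 (x +i* y) 0 1).
  by rewrite /SL2C /SL2 /= mx2_det mulr0 subr0 mulr1.
rewrite conj_tr_mx2 !mx2_mul mx2E conjc1 p0 s0; apply: contra M0.
rewrite eq_complex /= => /andP[/eqP h _].
have /eqP : x ^+ 2 + y ^+ 2 = 0 by lra.
rewrite paddr_eq0 ?sqr_ge0 // !sqrf_eq0 => /andP[/eqP -> /eqP ->].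
apply/eqP/matrixP=> -[[|[|//]] i] [[|[|//]] j]; rewrite !mxE /= ?p0 ?s0 //=.
by rewrite oppr0.
Qed.

(** Both forms are Hermitian of determinant -1; the matrix used is a Cayley
transform, which conjugates SU(1,1) to SL(2,R). *)
Lemma diag_split : congruent (mx2 1 0 0 (-1)) (im_form R).
Proof.
have i2 : imag R * imag R = -1 by rewrite -expr2 sqr_i.
have ic : (imag R)^*%C = - imag R by rewrite /imag /= -[RHS]/(- 0 -i* 1) oppr0.
pose r : R := (Num.sqrt 2)^-1.
have r2 : r * r = 2^-1 by rewrite -invfM -expr2 sqr_sqrtr.
have rC : r%:C * r%:C = 2^-1 by rewrite -rmorphM r2 fmorphV rmorph_nat.
exists (mx2 r%:C (r%:C * imag R) (r%:C * imag R) r%:C).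
  rewrite /SL2C /SL2 /= mx2_det.
  transitivity (r%:C * r%:C * (1 - imag R * imag R)); first by ring.
  by rewrite i2 rC; field.
exists 1; rewrite ?oner_neq0 // scale1r conj_tr_mx2 !mx2_mul !conjcM !conjc_real ic.
congr mx2.
- transitivity (r%:C * r%:C * (imag R * imag R) * (-2)); last by ring.
  by rewrite i2 rC; field.
- transitivity (r%:C * r%:C * imag R * (imag R * imag R + 1)); last by ring.
  by rewrite i2; ring.
- transitivity (- r%:C * r%:C * imag R * (imag R * imag R + 1)); last by ring.
  by rewrite i2; ring.
- transitivity (r%:C * r%:C * (imag R * imag R) * 2); last by ring.
  by rewrite i2 rC; field.
Qed.

Lemma congruent_complete_square p s x y : p != 0 ->
  congruent (herm p s x y)
    (mx2 1 0 0 ((p * s - x ^+ 2 - y ^+ 2) / p ^+ 2)%:C).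
Proof.
move=> p0; exists (mx2 1 0 ((x / p) -i* (y / p)) 1).
  by rewrite /SL2C /SL2 /= mx2_det mul0r subr0 mulr1.
exists p => //; rewrite conj_tr_mx2 !mx2_mul mx2_scale conjc0 conjc1.
congr mx2; apply/eqP; rewrite eq_complex /=; apply/andP; split; apply/eqP; by field.
Qed.

(** The congruence by diag(1/r, r) multiplies the quotient of the two diagonal
entries by r^4, so that r has to be a fourth root of -t. *)
Lemma congruent_diag_neg (t : R) : t < 0 ->
  congruent (mx2 1 0 0 t%:C) (mx2 1 0 0 (-1)).
Proof.
move=> t0; pose r := Num.sqrt (Num.sqrt (- t)).
have r0 : 0 < r by rewrite !sqrtr_gt0 oppr_gt0.
have r4 : r ^+ 2 * r ^+ 2 = - t.
  by rewrite sqr_sqrtr ?sqrtr_ge0 // -expr2 sqr_sqrtr // oppr_ge0 ltW.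
have rn0 := lt0r_neq0 r0.
exists (mx2 r^-1%:C 0 0 r%:C).
  by rewrite /SL2C /SL2 /= mx2_det mul0r subr0 -rmorphM mulVf.
exists (r ^+ 2); first by rewrite expf_neq0.
rewrite conj_tr_mx2 !conjc0 !conjc_real !mx2_mul mx2_scale.
have -> : t = - (r ^+ 2 * r ^+ 2) by rewrite r4 opprK.
congr mx2; apply/eqP; rewrite eq_complex /=; apply/andP; split; apply/eqP; by field.
Qed.

Lemma herm_classification M : conj_tr M = M -> M != 0 ->
  complex.Re (\det M) <= 0 ->
  congruent M (mx2 1 0 0 0) \/ congruent M (im_form R).
Proof.
move=> hM M0 dM; have [g dg] := herm_pivot hM M0.
have MM' := congruent_pullback M dg.
have [p [s [x [y e]]]] := self_adjoint_herm (conj_tr_congr g hM).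
move: MM' dM; rewrite -(det_congr _ dg) e det_herm mx2E eq_complex /= andbC eqxx /=.
move=> MM' dM p0.
have {MM'} := congruent_trans MM' (congruent_complete_square _ _ _ p0).
set t := _ / _ => MM'.
have : t <= 0 by rewrite /t pmulr_lle0 // invr_gt0 exprn_even_gt0.
rewrite le_eqVlt => /orP[/eqP t0|t0]; [left|right].
  by move: MM'; rewrite t0.
apply: congruent_trans MM' _; apply: congruent_trans diag_split.
exact: congruent_diag_neg.
Qed.

(** * A stabilizer is parametrized by the first row *)

(** The second row is obtained by solving A M = M (A^H)^-1 with det A = 1 for it.
The entries of M occur without conjugation, so that the result is visibly
continuous in M. *)
Definition completion M (a b : R[i]) : 'M[R[i]]_2 :=
  mx2 a b
    (((a - a^*%C) * M ord_max ord0 - b^*%C * M ord_max ord_max) / M ord0 ord0)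
    (a^*%C + (b * M ord_max ord0 + b^*%C * M ord0 ord_max) / M ord0 ord0).

(** The value r M r^H of the form on the row r = (a, b). *)
Definition row_form M (a b : R[i]) : R[i] :=
  a * a^*%C * M ord0 ord0 + a * b^*%C * M ord0 ord_max +
  b * a^*%C * M ord_max ord0 + b * b^*%C * M ord_max ord_max.

Lemma conj_tr_entries M : conj_tr M = M -> [/\ (M ord0 ord0)^*%C = M ord0 ord0,
  (M ord_max ord_max)^*%C = M ord_max ord_max &
  M ord_max ord0 = (M ord0 ord_max)^*%C].
Proof.
move=> hM; have h i j : (M i j)^*%C = M j i by rewrite -[in RHS]hM !mxE.
by split; rewrite ?h.
Qed.

(** The last matrix is the inverse of A^H, which for det A = 1 has no
denominators: in this form the condition on A is linear over the reals. *)
Lemma form_eq_linear M A : \det A = 1 ->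
  A *m M *m conj_tr A = M <->
  A *m M = M *m mx2 (A ord_max ord_max)^*%C (- (A ord_max ord0)^*%C)
                    (- (A ord0 ord_max)^*%C) (A ord0 ord0)^*%C.
Proof.
move=> dA; set X := mx2 _ _ _ _.
have XA : X *m conj_tr A = 1%:M.
  move: dA; rewrite /X [A]mx2_eta !mx2E conj_tr_mx2 mx2_det mx2_mul mx2_1.
  move=> /(congr1 (@conjc R)).
  by rewrite conjcB !conjcM conjc1 => dA; congr mx2; rewrite -?dA; ring.
have AX := mulmx1C XA.
split=> [e|->]; last by rewrite -mulmxA XA mulmx1.
by rewrite -[in RHS]e -mulmxA AX mulmx1.
Qed.

(** The determinant of the completed matrix is r M r^H divided by the upper left
entry of M, which is why the condition on r suffices. *)
Lemma form_group_completion M a b : conj_tr M = M -> M ord0 ord0 != 0 ->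
  row_form M a b = M ord0 ord0 -> form_group M (completion M a b).
Proof.
move=> /conj_tr_entries[]; rewrite /row_form.
set p := M ord0 ord0; set q := M ord0 ord_max; set s := M ord_max ord_max.
move=> rp rs eq p0; rewrite eq => e.
have dA : \det (completion M a b) = 1.
  rewrite mx2_det -/p -/q -/s eq.
  by transitivity (p / p); [rewrite -[X in _ = X / _]e; field|rewrite divff].
split=> //; apply/form_eq_linear => //.
rewrite !mx2E [X in _ *m X]mx2_eta [X in _ = X *m _]mx2_eta -/p -/q -/s eq.
rewrite /completion -/p -/q -/s eq !mx2_mul.
rewrite !(conjcM, conjcD, conjcN, conjc_inv, rp, rs, conjcK).
by congr mx2; field.
Qed.

(** The first row of A M = M (A^H)^-1 gives the conjugates of the entries c and d
of A, as soon as the upper left entry of M can be divided by. *)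
Lemma completionE M A : conj_tr M = M -> M ord0 ord0 != 0 -> form_group M A ->
  row_form M (A ord0 ord0) (A ord0 ord_max) = M ord0 ord0 /\
  A = completion M (A ord0 ord0) (A ord0 ord_max).
Proof.
move=> /conj_tr_entries[]; rewrite /row_form /completion.
set p := M ord0 ord0; set q := M ord0 ord_max; set s := M ord_max ord_max.
move=> rp rs eq p0 [dA eA]; split.
  rewrite -[RHS]/(M ord0 ord0) -[in RHS]eA [X in _ = (_ *m X *m _) _ _]mx2_eta.
  rewrite -/p -/q -/s eq [X in _ = (X *m _ *m conj_tr X) _ _]mx2_eta conj_tr_mx2 !mx2_mul.
  by rewrite mx2E; ring.
move/form_eq_linear: eA => /(_ dA).
rewrite [X in X *m _ = _]mx2_eta [X in _ *m X = _]mx2_eta [X in _ = X *m _]mx2_eta.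
rewrite -/p -/q -/s eq; set a := A ord0 ord0; set b := A ord0 ord_max.
set c := A ord_max ord0; set d := A ord_max ord_max.
rewrite !mx2_mul => /mx2_inj[e1 e2 _ _]; rewrite [LHS]mx2_eta; congr mx2.
  apply: (mulfI p0); apply/(can_inj (@conjcK R)).
  rewrite !(conjcM, conjcD, conjcN, conjc_inv, rp, rs, conjcK).
  transitivity (q * a^*%C - (a * q + b * s)); first by rewrite e2; ring.
  by field.
apply: (mulfI p0); apply/(can_inj (@conjcK R)).
rewrite !(conjcM, conjcD, conjcN, conjc_inv, rp, rs, conjcK).
transitivity (q * b^*%C + (a * p + b * q^*%C)); first by rewrite e1; ring.
by field.
Qed.

Lemma row_form_real M a b : conj_tr M = M ->
  row_form M a b / M ord0 ord0 = (complex.Re (row_form M a b / M ord0 ord0))%:C.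
Proof.
move=> /conj_tr_entries[rp rs eq].
have : (row_form M a b / M ord0 ord0)^*%C = row_form M a b / M ord0 ord0.
  rewrite /row_form eq !(conjcM, conjcD, conjc_inv, rp, rs, conjcK).
  by congr (_ / _); ring.
case: (_ / _) => x y [/= h]; rewrite /real_complex_def; congr Complex; lra.
Qed.

(** The value r M r^H is quadratic in r, so dividing r by the square root of D
turns a row that is only approximately admissible into an admissible one. *)
Lemma form_group_normalized M a b
    (D := complex.Re (row_form M a b / M ord0 ord0)) :
  conj_tr M = M -> 0 < D ->
  form_group M ((Num.sqrt D)^-1%:C *: completion M a b).
Proof.
move=> hM D0; have p0 : M ord0 ord0 != 0.
  by apply: contraTneq D0 => p0; rewrite /D p0 invr0 mulr0 ltxx.
set t := (Num.sqrt D)^-1.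
have tD : t * t * D = 1.
  rewrite /t -invfM -expr2 sqr_sqrtr ?ltW // mulVf //; exact: lt0r_neq0.
have -> : t%:C *: completion M a b = completion M (t%:C * a) (t%:C * b).
  rewrite /completion mx2_scale !conjcM !conjc_real; congr mx2; by field.
apply: form_group_completion => //.
rewrite -[RHS]mul1r -[in RHS](rmorph1 (real_complex R)) -tD !rmorphM /=.
rewrite /D -row_form_real // /row_form !conjcM !conjc_real.
by field.
Qed.

End FormGroup.

(** * Limits of complex numbers and matrices *)

Lemma mx_cvgP (T : topologicalType) (m n : nat) (I : Type)
    (F : set_system I) {FF : Filter F} (f : I -> 'M[T]_(m, n)) (L : 'M[T]_(m, n)) :
  f x @[x --> F] --> L <-> forall i j, f x i j @[x --> F] --> L i j.
Proof.
split=> [fL i j B LB|fL A [P LP sPA]].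
  apply: (fL [set M : 'M[T]_(m, n) | B (M i j)]).
  exists (fun i' j' => [set x | i = i' -> j = j' -> B x]) => [i' j'|M MB].
    have [[<- <-]|ne] := pselect (i = i' /\ j = j').
      by apply: filterS LB => x Bx _ _.
    by apply: filterS filterT => x _ e1 e2; case: ne; split.
  exact: MB.
have h : \forall x \near F, forall ij : 'I_m * 'I_n, P ij.1 ij.2 (f x ij.1 ij.2).
  by apply: filter_forall => -[i j]; exact: (fL i j _ (LP i j)).
by apply: filterS h => x hx; apply: sPA => i j; exact: (hx (i, j)).
Qed.

Section ComplexLimits.
Variable R : realType.
Variables (I : Type) (F : set_system I) (FF : Filter F).

Lemma cvg_conjc (f : I -> R[i]) (l : R[i]) :
  f x @[x --> F] --> l -> (f x)^*%C @[x --> F] --> l^*%C.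
Proof.
move=> /(@cvgrPdist_lt R[i] R[i]) fl; apply/(@cvgrPdist_lt R[i] R[i]) => e e0.
by apply: filterS (fl e e0) => x; rewrite -(rmorphB (@conjc R)) /= normcJ.
Qed.

Lemma cvg_Re (f : I -> R[i]) (l : R[i]) :
  f x @[x --> F] --> l -> complex.Re (f x) @[x --> F] --> complex.Re l.
Proof.
move=> /(@cvgrPdist_lt R[i] R[i]) fl; apply/cvgrPdist_lt => e e0.
have e0' : 0 < e%:C by rewrite ltcR.
apply: filterS (fl _ e0') => x h.
rewrite -ltcR; apply: le_lt_trans h.
by have := normc_ge_Re (l - f x); rewrite raddfB.
Qed.

Lemma cvg_real_complex (f : I -> R) (l : R) :
  f x @[x --> F] --> l -> (f x)%:C @[x --> F] --> l%:C.
Proof.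
move=> /cvgrPdist_lt fl; apply/(@cvgrPdist_lt R[i] R[i]) => e.
case: e => e e'; rewrite ltcE /= => /andP[/eqP -> e0].
apply: filterS (fl _ e0) => x h.
by rewrite -rmorphB normc_def /= expr0n addr0 sqrtr_sqr complexr0 ltcR.
Qed.

End ComplexLimits.

Section MatrixLimits.
Variable R : realType.
Variables (I : Type) (F : set_system I) (FF : Filter F).
Implicit Types (f g : I -> 'M[R[i]]_2) (A B : 'M[R[i]]_2).

Lemma cvg_mx2 (a b c d : I -> R[i]) (a' b' c' d' : R[i]) :
  a x @[x --> F] --> a' -> b x @[x --> F] --> b' ->
  c x @[x --> F] --> c' -> d x @[x --> F] --> d' ->
  mx2 (a x) (b x) (c x) (d x) @[x --> F] --> mx2 a' b' c' d'.
Proof.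
move=> ha hb hc hd; apply/mx_cvgP => i j.
have e (p q r s : R[i]) : mx2 p q r s i j =
  (if i == ord0 then (if j == ord0 then p else q)
   else (if j == ord0 then r else s)).
  by rewrite mxE; case: i j => [[|[|//]] ?] [[|[|//]] ?].
rewrite e; under eq_cvg do rewrite e.
case: ifP => _; case: ifP => _.
- exact: ha.
- exact: hb.
- exact: hc.
- exact: hd.
Qed.

Lemma cvg_mulmx f g A B : f x @[x --> F] --> A -> g x @[x --> F] --> B ->
  f x *m g x @[x --> F] --> A *m B.
Proof.
move=> /mx_cvgP fA /mx_cvgP gB.
under eq_cvg do rewrite [f _]mx2_eta [g _]mx2_eta mx2_mul.
rewrite [A]mx2_eta [B]mx2_eta mx2_mul.
by apply: cvg_mx2; apply: (@cvgD R[i] R[i]); apply: (@cvgM R[i]).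
Qed.

Lemma cvg_conj_tr f A : f x @[x --> F] --> A ->
  conj_tr (f x) @[x --> F] --> conj_tr A.
Proof.
move=> /mx_cvgP fA; apply/mx_cvgP => i j.
rewrite conj_trE; under eq_cvg do rewrite conj_trE.
exact: cvg_conjc.
Qed.

Lemma cvg_scale_mx (c : I -> R[i]) (k : R[i]) f A :
  c x @[x --> F] --> k -> f x @[x --> F] --> A ->
  c x *: f x @[x --> F] --> k *: A.
Proof.
move=> ck /mx_cvgP fA; apply/mx_cvgP => i j.
have e (a : R[i]) (M : 'M[R[i]]_2) : (a *: M) i j = a * M i j by rewrite mxE.
rewrite e; under eq_cvg do rewrite e.
by apply: (@cvgM R[i]) ck (fA i j).
Qed.

Lemma cvg_herm (p s x y : I -> R) (p' s' x' y' : R) :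
  p n @[n --> F] --> p' -> s n @[n --> F] --> s' ->
  x n @[n --> F] --> x' -> y n @[n --> F] --> y' ->
  herm (p n) (s n) (x n) (y n) @[n --> F] --> herm p' s' x' y'.
Proof.
move=> hp hs hx hy.
have cC (u v : I -> R) (u' v' : R) : u n @[n --> F] --> u' ->
    v n @[n --> F] --> v' -> (u n +i* v n) @[n --> F] --> (u' +i* v').
  move=> hu hv; rewrite [u' +i* v']complexE.
  under eq_cvg do rewrite [_ +i* _]complexE.
  apply: (@cvgD R[i] R[i]); first exact: cvg_real_complex.
  apply: (@cvgM R[i]); [exact: cvg_cst|exact: cvg_real_complex].
apply: cvg_mx2; rewrite ?complexr0; try exact: cvg_real_complex; apply: cC => //.
exact: cvgN.
Qed.

End MatrixLimits.

Lemma mx_cvg_unique (R : realType) (I : Type) (F : set_system I)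
  {FF : ProperFilter F} (f : I -> 'M[R[i]]_2) (A B : 'M[R[i]]_2) :
  f x @[x --> F] --> A -> f x @[x --> F] --> B -> A = B.
Proof.
move=> /mx_cvgP fA /mx_cvgP fB; apply/matrixP => i j.
apply: (cvg_unique (@norm_hausdorff R[i] R[i]) (fA i j) (fB i j)).
Qed.

Lemma cvg_subseq (T : topologicalType) (u : nat -> T) (l : T) (k : nat -> nat) :
  {homo k : m n / (m < n)%N} -> u n @[n --> \oo] --> l ->
  u (k n) @[n --> \oo] --> l.
Proof.
move=> hk ul; apply: (cvg_comp k u) ul => A [N _ NA]; exists N => // n /= Nn.
apply: NA => /=; apply: leq_trans Nn _.
elim: n => // n ih; exact: leq_ltn_trans ih (hk _ _ (ltnSn n)).
Qed.

Lemma bounded_family_subseq (R : realType) (m : nat) (u : nat -> nat -> R) :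
  (forall i n, `|u i n| <= 1) ->
  exists2 k : nat -> nat, {homo k : m n / (m < n)%N} &
  exists l : nat -> R, forall i, (i < m)%N -> u i (k n) @[n --> \oo] --> l i.
Proof.
move=> ub; elim: m => [|m [k hk [l hl]]]; first by exists id => //; exists (fun=> 0).
have bu : bounded_fun (u m \o k).
  exists 1; split; first exact: num_real.
  by move=> M M1 n _ /=; apply: le_trans (ub _ _) (ltW M1).
have [f finc /cvg_ex[/= l' hl']] := bolzano_weierstrass bu.
have hf : {homo f : m n / (m < n)%N}.
  by move=> a b ab; rewrite ltnNge -leEnat finc -ltnNge.
exists (k \o f); first by move=> a b ab /=; apply/hk/hf.
(* Passing to the further subsequence keeps the limits found so far. *)
exists (fun i => if i == m then l' else l i) => i; rewrite ltnS leq_eqVlt.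
case: eqVneq => [->|_ /= im] //=.
exact: (cvg_subseq hf (hl _ im)).
Qed.

(** * Chabauty limits *)

Section ChabautyLimits.
Variable R : realType.
Implicit Types (A M g : 'M[R[i]]_2).

(** Division by the sum of the absolute values of the coordinates gives points
of the unit sphere of the l^1 norm: a limit is not 0. The determinants are
negative, and may tend to 0. *)
Lemma herm_subsequence (Mn : nat -> 'M[R[i]]_2) :
  (forall n, conj_tr (Mn n) = Mn n) -> (forall n, \det (Mn n) = -1) ->
  exists2 k : nat -> nat, {homo k : m n / (m < n)%N} &
  exists2 c : nat -> R, (forall n, c n != 0) &
  exists M, [/\ conj_tr M = M, M != 0, complex.Re (\det M) <= 0 &
    (c n)%:C *: Mn (k n) @[n --> \oo] --> M].
Proof.
move=> hM dM.
have /choice[v hv] : forall n, exists v : R * R * (R * R),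
    Mn n = herm v.1.1 v.1.2 v.2.1 v.2.2.
  by move=> n; have [p [s [x [y ->]]]] := self_adjoint_herm (hM n); exists (p, s, (x, y)).
pose p n := (v n).1.1; pose s n := (v n).1.2.
pose x n := (v n).2.1; pose y n := (v n).2.2.
have dv n : p n * s n - x n ^+ 2 - y n ^+ 2 = -1.
  apply: (@complexI R); have := dM n; rewrite hv det_herm => ->.
  by rewrite rmorphN rmorph1.
pose N n := `|p n| + `|s n| + `|x n| + `|y n|.
have N0 n : 0 < N n.
  rewrite lt0r; apply/andP; split; last by rewrite !addr_ge0.
  apply/negP; rewrite !paddr_eq0 ?addr_ge0 // !normr_eq0.
  move=> /andP[/andP[/andP[/eqP p0 /eqP s0] /eqP x0] /eqP y0].
  by have := dv n; rewrite p0 s0 x0 y0; lra.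
have Nn0 n : N n != 0 by exact: lt0r_neq0.
pose u i n := nth 0 [:: p n; s n; x n; y n] i / N n.
have ub i n : `|u i n| <= 1.
  rewrite /u normrM normfV (gtr0_norm (N0 n)) ler_pdivrMr // mul1r /N.
  have := normr_ge0 (p n); have := normr_ge0 (s n).
  have := normr_ge0 (x n); have := normr_ge0 (y n).
  by case: i => [|[|[|[|i]]]] /= ? ? ? ?; rewrite ?nth_nil ?normr0; lra.
have [k hk [l hl]] := bounded_family_subseq 4 ub.
have l0 := hl 0%N isT; have l1 := hl 1%N isT.
have l2 := hl 2%N isT; have l3 := hl 3%N isT.
exists k => //; exists (fun n => (N (k n))^-1) => [n|]; first by rewrite invr_neq0.
exists (herm (l 0%N) (l 1%N) (l 2%N) (l 3%N)); split.
- exact: conj_tr_herm.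
- apply/eqP => M0.
  have lz : [/\ l 0%N = 0, l 1%N = 0, l 2%N = 0 & l 3%N = 0].
    move: (M0); rewrite [X in _ = X]mx2_eta !mxE.
    by move=> /mx2_inj[[->] [-> ->] _ [->]].
  have sum1 n : `|u 0 (k n)| + `|u 1 (k n)| + `|u 2 (k n)| + `|u 3 (k n)| = 1.
    rewrite /u /= !normrM !normfV (gtr0_norm (N0 _)) -!mulrDl.
    by rewrite -/(N (k n)) divff.
  have : `|u 0 (k n)| + `|u 1 (k n)| + `|u 2 (k n)| + `|u 3 (k n)|
      @[n --> \oo] --> `|l 0%N| + `|l 1%N| + `|l 2%N| + `|l 3%N|.
    by do 3?[apply: cvgD]; apply: cvg_norm.
  have [-> -> -> ->] := lz; rewrite normr0 !addr0 => h0.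
  have : 1 <= 0 :> R by apply: (cvgr_to_ge h0); apply: nearW => n; rewrite -(sum1 n).
  by rewrite ler10.
- rewrite det_herm /=.
  rewrite !expr2.
  have h : u 0 (k n) * u 1 (k n) - u 2 (k n) * u 2 (k n) - u 3 (k n) * u 3 (k n)
      @[n --> \oo] --> l 0%N * l 1%N - l 2%N * l 2%N - l 3%N * l 3%N.
    by do 2?[apply: cvgB]; apply: cvgM.
  apply: (cvgr_to_le h); apply: nearW => n /=.
  have -> : u 0 (k n) * u 1 (k n) - u 2 (k n) * u 2 (k n) - u 3 (k n) * u 3 (k n)
      = (p (k n) * s (k n) - x (k n) ^+ 2 - y (k n) ^+ 2) / N (k n) ^+ 2.
    by rewrite /u /=; field; exact: Nn0.
  by rewrite dv mulN1r oppr_le0 invr_ge0 sqr_ge0.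
have e n : (N (k n))^-1%:C *: Mn (k n) =
    herm (u 0 (k n)) (u 1 (k n)) (u 2 (k n)) (u 3 (k n)).
  rewrite hv /herm mx2_scale /u /=; congr mx2;
    apply/eqP; rewrite eq_complex /=; apply/andP; split; apply/eqP; field; exact: Nn0.
under eq_cvg do rewrite e.
exact: cvg_herm.
Qed.

Lemma conj_tr_limit (Mn : nat -> 'M[R[i]]_2) M :
  (forall n, conj_tr (Mn n) = Mn n) -> Mn n @[n --> \oo] --> M -> conj_tr M = M.
Proof.
move=> hM cM; apply: (mx_cvg_unique _ cM).
under eq_cvg do rewrite -hM.
exact: (cvg_conj_tr _ cM).
Qed.

(** The approximants have the first row of A up to a real factor, which tends to
1; the value of that row under Mn tends to its value under M. *)
Lemma form_group_approx_pivot (Mn : nat -> 'M[R[i]]_2) M A :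
  (forall n, conj_tr (Mn n) = Mn n) -> Mn n @[n --> \oo] --> M ->
  M ord0 ord0 != 0 -> form_group M A ->
  exists2 u : nat -> 'M[R[i]]_2, (forall n, form_group (Mn n) (u n)) &
    u n @[n --> \oo] --> A.
Proof.
move=> hMn cM p0 hA; have hM := conj_tr_limit hMn cM.
have [rA eA] := completionE hM p0 hA.
set a := A ord0 ord0 in rA eA; set b := A ord0 ord_max in rA eA.
pose D n := complex.Re (row_form (Mn n) a b / Mn n ord0 ord0).
(* D n may fail to be positive for finitely many n, where any element will do. *)
pose u n := if 0 < D n then (Num.sqrt (D n))^-1%:C *: completion (Mn n) a b
            else 1%:M.
move/mx_cvgP: cM => cM.
have cp := cM ord0 ord0; have cq := cM ord0 ord_max.
have cr := cM ord_max ord0; have cs := cM ord_max ord_max.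
have cpV := @cvgV R[i] _ _ _ _ _ p0 cp.
have cK (z : R[i]) : (fun=> z) @ \oo --> z by exact: cvg_cst.
have cD : D n @[n --> \oo] --> (1 : R).
  have -> : (1 : R) = complex.Re (row_form M a b / M ord0 ord0).
    by rewrite rA divff.
  apply: cvg_Re; apply: (@cvgM R[i]); last exact: cpV.
  apply: (@cvgD R[i] R[i]); last by apply: (@cvgM R[i]) (cK _) cs.
  apply: (@cvgD R[i] R[i]); last by apply: (@cvgM R[i]) (cK _) cr.
  apply: (@cvgD R[i] R[i]); last by apply: (@cvgM R[i]) (cK _) cq.
  by apply: (@cvgM R[i]) (cK _) cp.
have Dpos : \forall n \near \oo, 0 < D n by apply: (cvgr_gt _ cD); exact: ltr01.
have cC : completion (Mn n) a b @[n --> \oo] --> A.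
  rewrite eA -/a -/b; apply: cvg_mx2; [exact: cK|exact: cK|..].
    apply: (@cvgM R[i]); last exact: cpV.
    apply: (@cvgB R[i] R[i]); first exact: (@cvgM R[i] _ _ _ _ _ _ _ (cK _) cr).
    exact: (@cvgM R[i] _ _ _ _ _ _ _ (cK _) cs).
  apply: (@cvgD R[i] R[i]); first exact: cK.
  apply: (@cvgM R[i]); last exact: cpV.
  apply: (@cvgD R[i] R[i]); first exact: (@cvgM R[i] _ _ _ _ _ _ _ (cK _) cr).
  exact: (@cvgM R[i] _ _ _ _ _ _ _ (cK _) cq).
exists u => [n|].
  rewrite /u; case: ifP => D0; first exact: form_group_normalized.
  by have [_] := form_group_subgroup (Mn n).
have ct : (Num.sqrt (D n))^-1 @[n --> \oo] --> (1 : R).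
  rewrite -[X in _ --> X]invr1 -[X in X^-1]sqrtr1; apply: cvgV.
    by rewrite sqrtr1 oner_neq0.
  by apply: (continuous_cvg _ _ cD); exact: sqrt_continuous.
have : (Num.sqrt (D n))^-1%:C *: completion (Mn n) a b @[n --> \oo] --> A.
  by rewrite -[A]scale1r; apply: cvg_scale_mx cC; exact: cvg_real_complex ct.
apply: cvg_trans; apply: near_eq_cvg.
by apply: filterS Dpos => n D0; rewrite /u D0.
Qed.

Lemma form_group_approx (Mn : nat -> 'M[R[i]]_2) M A :
  (forall n, conj_tr (Mn n) = Mn n) -> Mn n @[n --> \oo] --> M ->
  M != 0 -> form_group M A ->
  exists2 u : nat -> 'M[R[i]]_2, (forall n, form_group (Mn n) (u n)) &
    u n @[n --> \oo] --> A.
Proof.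
move=> hMn cM M0 hA; have hM := conj_tr_limit hMn cM.
have [g dg p0] := herm_pivot hM M0; have ug := SL2_unit dg.
have cK (Z : 'M[R[i]]_2) : (fun=> Z) @ \oo --> Z by exact: cvg_cst.
have cM' : g *m Mn n *m conj_tr g @[n --> \oo] --> g *m M *m conj_tr g.
  by apply: cvg_mulmx (cK _); apply: cvg_mulmx (cK _) cM.
have hA' : form_group (g *m M *m conj_tr g) (g *m A *m invmx g).
  by rewrite form_group_congr //; exists A.
have [u hu cu] := form_group_approx_pivot
  (fun n => conj_tr_congr g (hMn n)) cM' p0 hA'.
exists (fun n => invmx g *m u n *m g) => [n|].
  have := hu n; rewrite form_group_congr // => -[h hh <-].
  by rewrite !mulmxA mulVmx // mul1mx mulmxKV.
have -> : A = invmx g *m (g *m A *m invmx g) *m g.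
  by rewrite !mulmxA mulVmx // mul1mx mulmxKV.
by apply: cvg_mulmx (cK _); apply: cvg_mulmx (cK _) cu.
Qed.

(** Only a subsequence of the forms converges. This is enough, since condition
(2) of Chabauty convergence is about limits along subsequences. *)
Lemma chabauty_limit_form_group (Mn : nat -> 'M[R[i]]_2) (L : set 'M[R[i]]_2) :
  (forall n, conj_tr (Mn n) = Mn n) -> (forall n, \det (Mn n) = -1) ->
  L `<=` SL2C R -> chabauty_cvg (SL2C R) (fun n => form_group (Mn n)) L ->
  exists M, [/\ conj_tr M = M, M != 0, complex.Re (\det M) <= 0 &
    L = form_group M].
Proof.
move=> hM dM LSL [Llim Lacc].
have [k hk [c c0 [M [hM' M0 dM' cM]]]] := herm_subsequence hM dM.
have fc n : form_group ((c n)%:C *: Mn (k n)) = form_group (Mn (k n)).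
  by rewrite form_group_scale // eq_complex /= negb_and c0.
exists M; split=> //; apply/seteqP; split=> A.
  move=> LA; split; first exact: LSL.
  have [u hu uA] := Llim A LA.
  have ukA := cvg_subseq hk uA.
  have e n : u (k n) *m ((c n)%:C *: Mn (k n)) *m conj_tr (u (k n)) =
      (c n)%:C *: Mn (k n).
    by have := hu (k n); rewrite -fc => -[].
  apply: (mx_cvg_unique _ cM); under eq_cvg do rewrite -e.
  by apply: cvg_mulmx (cvg_conj_tr _ ukA); apply: cvg_mulmx ukA cM.
move=> MA; have hcM n : conj_tr ((c n)%:C *: Mn (k n)) = (c n)%:C *: Mn (k n).
  by rewrite conj_tr_scale hM.
have [w hw wA] := form_group_approx hcM cM M0 MA.
have kinj : injective k.
  move=> i j; case: (ltngtP i j) => // /hk; first by move=> + e; rewrite e ltnn.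
  by move=> + e; rewrite e ltnn.
(* The approximants w n live at the indices k n; elsewhere take the identity. *)
pose u m := if pselect (exists n, k n = m) is left h then w (projT1 (cid h))
            else 1%:M.
have uk n : u (k n) = w n.
  rewrite /u; case: pselect => [h|[]]; last by exists n.
  by case: cid => j /= /kinj ->.
apply: (Lacc u k).
- move=> m; rewrite /u; case: pselect => [h|_].
    by case: cid => j /= <-; rewrite -fc.
  by have [_] := form_group_subgroup (Mn m).
- exact: hk.
- by have -> : u \o k = w by apply/funext.
- by case: MA.
Qed.
End ChabautyLimits.

Theorem theorem1p5 (R : realType) :
  is_subgroup (borelC R) (circle_translations R) /\
  forall L : set 'M[R[i]]_2,
    is_chabauty_limit (SL2C R) (SL2R R) L ->
    exists2 g : 'M[R[i]]_2, SL2C R g &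
      L = conj_subgroup g (SL2R R) \/
      L = conj_subgroup g (circle_translations R).
Proof.
split.
  have [sub one mul inv] := form_group_subgroup (mx2 1 0 0 0 : 'M[R[i]]_2).
  rewrite form_group_diag10 in sub one mul inv.
  split=> // A circA; split; first exact: sub.
  by case: circA => a [b [z [_ ->]]]; rewrite mx2E.
move=> L [[[LSL _ _ _] _] [g dg cvL]].
pose Mn n := g n *m im_form R *m conj_tr (g n).
have him : conj_tr (im_form R) = im_form R.
  by rewrite conj_tr_mx2 conjc0; congr mx2; rewrite /imag /=;
    congr Complex; rewrite ?oppr0 ?opprK.
have dim : \det (im_form R) = -1.
  by rewrite mx2_det mulr0 sub0r mulrN opprK -expr2 sqr_i.
have e : (fun n => conj_subgroup (g n) (SL2R R)) = (fun n => form_group (Mn n)).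
  by apply/funext => n; rewrite form_group_congr // form_group_im.
rewrite e in cvL.
have [|n|M [hM M0 dM ->]] := chabauty_limit_form_group _ _ LSL cvL.
- by move=> n; exact: conj_tr_congr.
- by rewrite det_congr.
have [/congruent_form_group[h dh ->]|/congruent_form_group[h dh ->]] :=
  herm_classification hM M0 dM; exists h => //; [right|left].
  by rewrite form_group_diag10.
by rewrite form_group_im.
Qed.
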